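(* Let $(V,\rho,\beta)$ be a representation of an $n$-Hom-Lie algebra $(\mathfrak g,[\cdot,\cdots,\cdot]_{\mathfrak g},\alpha)$, where $\beta$ is invertible. Define $\rho^*:\wedge^{n-1}\mathfrak g\to\mathfrak{gl}(V^* )$ by $\langle\rho^*(X)(\xi),u\rangle=-\langle\xi,\rho(X)(u)\rangle$ and define $\rho^\star:\wedge^{n-1}\mathfrak g\to\mathfrak{gl}(V^* )$ by $$\rho^\star(X)(\xi)=\rho^*(\widetilde\alpha(X))\big((\beta^{-2})^*(\xi)\big)$$ for all $X\in\wedge^{n-1}\mathfrak g$, $u\in V$, $\xi\in V^*$. Then $(V^*,\rho^\star,(\beta^{-1})^* )$ is also a representation of $(\mathfrak g,[\cdot,\cdots,\cdot]_{\mathfrak g},\alpha)$.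
   Context: All vector spaces are over an algebraically closed field $\mathbb K$ of characteristic $0$; $n\ge2$ is an integer. For a linear map $\gamma:V\to V$, $\gamma^*:V^*\to V^*$ denotes the transpose, $\langle\gamma^*(\xi),u\rangle=\langle\xi,\gamma(u)\rangle$. An $n$-Hom-Lie algebra $(\mathfrak g,[\cdot,\cdots,\cdot]_{\mathfrak g},\alpha)$ is a vector space $\mathfrak g$ with a linear map $[\cdot,\cdots,\cdot]_{\mathfrak g}:\wedge^n\mathfrak g\to\mathfrak g$ and an algebra automorphism $\alpha:\mathfrak g\to\mathfrak g$ (a linear bijection with $\alpha[x_1,\ldots,x_n]_{\mathfrak g}=[\alpha(x_1),\ldots,\alpha(x_n)]_{\mathfrak g}$) such that for all $x_1,\ldots,x_{n-1},y_1,\ldots,y_n\in\mathfrak g$ $$[\alpha(x_1),\ldots,\alpha(x_{n-1}),[y_1,\ldots,y_n]_{\mathfrak g}]_{\mathfrak g}=\sum_{i=1}^n[\alpha(y_1),\ldots,\alpha(y_{i-1}),[x_1,\ldots,x_{n-1},y_i]_{\mathfrak g},\alpha(y_{i+1}),\ldots,\alpha(y_n)]_{\mathfrak g}.$$ Define $\widetilde\alpha:\wedge^{n-1}\mathfrak g\to\wedge^{n-1}\mathfrak g$ by $\widetilde\alpha(x_1\wedge\cdots\wedge x_{n-1})=\alpha(x_1)\wedge\cdots\wedge\alpha(x_{n-1})$. For $X=x_1\wedge\cdots\wedge x_{n-1}$, $Y=y_1\wedge\cdots\wedge y_{n-1}$ put $$[X,Y]_F=\sum_{i=1}^{n-1}\alpha(y_1)\wedge\cdots\wedge\alpha(y_{i-1})\wedge[x_1,\ldots,x_{n-1},y_i]_{\mathfrak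 g}\wedge\alpha(y_{i+1})\wedge\cdots\wedge\alpha(y_{n-1}),$$ extended bilinearly. A representation $(V,\rho,\beta)$ of $\mathfrak g$ consists of a vector space $V$, $\beta\in GL(V)$ and a linear map $\rho:\wedge^{n-1}\mathfrak g\to\mathfrak{gl}(V)$ (we write $\rho(x_1,\ldots,x_{n-1})=\rho(x_1\wedge\cdots\wedge x_{n-1})$) such that for all $X,Y\in\wedge^{n-1}\mathfrak g$ and $x_1,\ldots,x_{n-2},y_1,\ldots,y_n\in\mathfrak g$: (i) $\rho(\widetilde\alpha(X))\circ\beta=\beta\circ\rho(X)$; (ii) $\rho(\widetilde\alpha(X))\circ\rho(Y)-\rho(\widetilde\alpha(Y))\circ\rho(X)=\rho([X,Y]_F)\circ\beta$; (iii) $\rho(\alpha(x_1),\ldots,\alpha(x_{n-2}),[y_1,\ldots,y_n]_{\mathfrak g})\circ\beta=\sum_{i=1}^n(-1)^{n-i}\rho(\alpha(y_1),\ldots,\widehat{\alpha(y_i)},\ldots,\alpha(y_n))\circ\rho(x_1,\ldots,x_{n-2},y_i)$, where a hat means omission. *)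

(* Defs.v *)
(* Vector spaces are [lmodType]s of arbitrary dimension, so the choice structure
   on spaces of linear maps and the decidability of the relation defining the
   exterior powers come from the classical axioms of boolp. *)
From HB Require Import structures.
From mathcomp Require Import all_boot all_order all_algebra generic_quotient.
From mathcomp Require Import ring_quotient.
From mathcomp Require Import boolp freeg.

Set Implicit Arguments.
Unset Strict Implicit.
Unset Printing Implicit Defensive.

Import GRing.Theory.
Local Open Scope ring_scope.
Local Open Scope quotient_scope.

Section Hom.
Context {K : fieldType} {U V : lmodType K}.
Implicit Types f g h : {linear U -> V}.

Lemma linP f g : (forall u, f u = g u) -> f = g.
Proof.
case: f g => [f [[cf] [df]]] [g [[cg] [dg]]] /= /funext fg.
rewrite -{}fg in cg dg *.
by rewrite (Prop_irrelevance cg cf) (Prop_irrelevance dg df).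
Qed.

HB.instance Definition _ := gen_eqMixin {linear U -> V}.
HB.instance Definition _ := gen_choiceMixin {linear U -> V}.

Definition lin_zero : {linear U -> V} := \0%R.
Definition lin_opp f : {linear U -> V} := \- f.
Definition lin_add f g : {linear U -> V} := f \+ g.
Definition lin_scale (a : K) f : {linear U -> V} := a \*: f.

Fact lin_addA : associative lin_add.
Proof. by move=> f g h; apply: linP => u; rewrite /= addrA. Qed.
Fact lin_addC : commutative lin_add.
Proof. by move=> f g; apply: linP => u; rewrite /= addrC. Qed.
Fact lin_add0 : left_id lin_zero lin_add.
Proof. by move=> f; apply: linP => u; rewrite /= add0r. Qed.
Fact lin_addN : left_inverse lin_zero lin_opp lin_add.
Proof. by move=> f; apply: linP => u; rewrite /= addNr. Qed.
HB.instance Definition _ :=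
  GRing.isZmodule.Build {linear U -> V} lin_addA lin_addC lin_add0 lin_addN.

Fact lin_scaleA a b f : lin_scale a (lin_scale b f) = lin_scale (a * b) f.
Proof. by apply: linP => u; rewrite /= scalerA. Qed.
Fact lin_scale1 : left_id 1 lin_scale.
Proof. by move=> f; apply: linP => u; rewrite /= scale1r. Qed.
Fact lin_scaleDr : right_distributive lin_scale +%R.
Proof. by move=> a f g; apply: linP => u; rewrite /= scalerDr. Qed.
Fact lin_scaleDl f : {morph lin_scale^~ f : a b / a + b}.
Proof. by move=> a b; apply: linP => u; rewrite /= scalerDl. Qed.
HB.instance Definition _ := GRing.Zmodule_isLmodule.Build K {linear U -> V}
  lin_scaleA lin_scale1 lin_scaleDr lin_scaleDl.

Lemma lin_addE f g u : (f + g) u = f u + g u. Proof. by []. Qed.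
Lemma lin_oppE f u : (- f) u = - f u. Proof. by []. Qed.
Lemma lin_scaleE a f u : (a *: f) u = a *: f u. Proof. by []. Qed.

End Hom.

(* Packs a function with a proof of linearity; it computes, so that
   [LinMap fP u] is convertible to [f u]. *)
Section LinMap.
Context {K : fieldType} {U V : lmodType K} (f : U -> V).
Hypothesis fP : forall a u v, f (a *: u + v) = a *: f u + f v.
Definition lin_fun of (forall a u v, f (a *: u + v) = a *: f u + f v) := f.
HB.instance Definition _ :=
  GRing.isLinear.Build K U V *:%R (lin_fun fP) fP.
Definition LinMap : {linear U -> V} := lin_fun fP.
End LinMap.

(* V^* *)
Definition dual (K : fieldType) (V : lmodType K) : lmodType K :=
  {linear V -> K^o}.

Section Transpose.
Context {K : fieldType} {V W : lmodType K}.

Definition transpose_fun (f : {linear V -> W}) (xi : dual W) : dual V :=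
  xi \o f.

Fact transpose_linear f a xi eta :
  transpose_fun f (a *: xi + eta) =
  a *: transpose_fun f xi + transpose_fun f eta.
Proof. exact: linP. Qed.

Definition transpose f : {linear dual W -> dual V} :=
  LinMap (transpose_linear f).

Lemma transposeE f xi u : transpose f xi u = xi (f u).
Proof. by []. Qed.

End Transpose.

(* GL(V): an invertible linear map together with its (unique) inverse. *)
Record GL (K : fieldType) (V : lmodType K) := MkGL {
  gl_fun :> {linear V -> V};
  gl_inv : {linear V -> V};
  gl_funK : cancel gl_fun gl_inv;
  gl_invK : cancel gl_inv gl_fun }.

Definition GLinv (K : fieldType) (V : lmodType K) (b : GL V) : GL V :=
  MkGL (gl_invK b) (gl_funK b).

Section GLtranspose.
Context {K : fieldType} {V : lmodType K} (b : GL V).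

Fact transposeK : cancel (transpose b) (transpose (gl_inv b)).
Proof. by move=> xi; apply: linP => u; rewrite !transposeE gl_invK. Qed.
Fact transposeVK : cancel (transpose (gl_inv b)) (transpose b).
Proof. by move=> xi; apply: linP => u; rewrite !transposeE gl_funK. Qed.

Definition GLtranspose : GL (dual V) := MkGL transposeK transposeVK.

End GLtranspose.

Section Exterior.
Context {K : fieldType} {g : lmodType K}.

Definition tupd (n : nat) (x : n.-tuple g) (i : 'I_n) (u : g) : n.-tuple g :=
  [tuple if j == i then u else tnth x j | j < n].

Section Power.
Variable n : nat.

Record altmap (W : lmodType K) := AltMap {
  alt_fun :> n.-tuple g -> W;
  alt_linear : forall x i a u v,
    alt_fun (tupd x i (a *: u + v)) =
    a *: alt_fun (tupd x i u) + alt_fun (tupd x i v);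
  alt_eq0 : forall x i j,
    i != j -> tnth x i = tnth x j -> alt_fun x = 0 }.

(* The subspace of the free vector space on [n.-tuple g] that is killed in the
   n-th exterior power: the span of the multilinearity relations and of the
   tuples with a repeated entry. *)
Inductive ext_rel : {freeg (n.-tuple g) / K} -> Prop :=
| ExtRel0 : ext_rel 0
| ExtRelLin a D E of ext_rel D & ext_rel E : ext_rel (a *: D + E)
| ExtRelMul x i a u v :
    ext_rel (<< tupd x i (a *: u + v) >>
             - (a *: << tupd x i u >> + << tupd x i v >>))
| ExtRelAlt x i j of i != j & tnth x i = tnth x j : ext_rel << x >>.

Definition ext_relb : {pred {freeg (n.-tuple g) / K}} :=
  fun D => `[< ext_rel D >].

Lemma ext_relbP D : reflect (ext_rel D) (D \in ext_relb).
Proof. exact: asboolP. Qed.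

Fact ext_rel_zmod : zmod_closed ext_relb.
Proof.
split; first exact/ext_relbP/ExtRel0.
move=> D E /ext_relbP hD /ext_relbP hE; apply/ext_relbP.
by rewrite addrC -scaleN1r; apply: ExtRelLin.
Qed.
HB.instance Definition _ :=
  GRing.isZmodClosed.Build {freeg (n.-tuple g) / K} ext_relb ext_rel_zmod.

Definition ext := {ideal_quot ext_relb}.
HB.instance Definition _ := GRing.Zmodule.on ext.

Definition ext_pi (D : {freeg (n.-tuple g) / K}) : ext := \pi D.

Lemma ext_piP D E : ext_pi D = ext_pi E <-> ext_rel (D - E).
Proof.
split=> [/eqP|/ext_relbP].
  by rewrite -ring_quotient.Quotient.idealrBE => /ext_relbP.
by rewrite ring_quotient.Quotient.idealrBE => /eqP.
Qed.

Lemma ext_piD : {morph ext_pi : D E / D + E}.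
Proof. by move=> D E; rewrite /ext_pi !piE. Qed.

Lemma ext_piK X : ext_pi (repr X) = X.
Proof. exact: reprK. Qed.

Definition ext_scale (a : K) (X : ext) : ext := ext_pi (a *: repr X).

Lemma ext_piZ a D : ext_pi (a *: D) = ext_scale a (ext_pi D).
Proof.
apply/ext_piP; rewrite -scalerBr -[_ *: _]addr0.
apply: ExtRelLin; last exact: ExtRel0.
by apply/ext_piP; rewrite ext_piK.
Qed.

Fact ext_scaleA a b X : ext_scale a (ext_scale b X) = ext_scale (a * b) X.
Proof. by rewrite -[X]ext_piK -!ext_piZ scalerA. Qed.
Fact ext_scale1 : left_id 1 ext_scale.
Proof. by move=> X; rewrite -[X]ext_piK -ext_piZ scale1r. Qed.
Fact ext_scaleDr : right_distributive ext_scale +%R.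
Proof.
move=> a X Y; rewrite -[X]ext_piK -[Y]ext_piK -ext_piD -!ext_piZ scalerDr.
exact: ext_piD.
Qed.
Fact ext_scaleDl X : {morph ext_scale^~ X : a b / a + b}.
Proof. by move=> a b; rewrite -[X]ext_piK -!ext_piZ scalerDl ext_piD. Qed.
HB.instance Definition _ := GRing.Zmodule_isLmodule.Build K ext
  ext_scaleA ext_scale1 ext_scaleDr ext_scaleDl.

Definition wedge (x : n.-tuple g) : ext := ext_pi << x >>.

Lemma ext_pi_lin a D E : ext_pi (a *: D + E) = a *: ext_pi D + ext_pi E.
Proof. by rewrite ext_piD ext_piZ. Qed.

Lemma wedge_linear x i a u v :
  wedge (tupd x i (a *: u + v)) =
  a *: wedge (tupd x i u) + wedge (tupd x i v).
Proof. by rewrite /wedge -ext_pi_lin; apply/ext_piP/ExtRelMul. Qed.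

Lemma ext_pi0 : ext_pi 0 = 0.
Proof. by apply: (addrI (ext_pi 0)); rewrite -ext_piD !addr0. Qed.

Lemma wedge_eq0 x i j : i != j -> tnth x i = tnth x j -> wedge x = 0.
Proof.
move=> ij xij; rewrite /wedge -ext_pi0; apply/ext_piP; rewrite subr0.
exact: ExtRelAlt xij.
Qed.

Lemma ext_ind (P : ext -> Prop) :
  P 0 -> (forall a x X, P X -> P (a *: wedge x + X)) -> forall X, P X.
Proof.
move=> P0 PS X; rewrite -[X]ext_piK -[repr X]freeg_sumE.
elim: (dom _) => [|x s IHs]; first by rewrite big_nil ext_pi0.
rewrite big_cons -[coeff _ _]mulr1.
have -> (c : K) : << (c * 1) *g x >> = c *: << x >>.
  by apply/eqP/freeg_eqP => y; rewrite coeffZ !coeffU mulr1 mul1r.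
by rewrite ext_pi_lin; apply: PS.
Qed.

Lemma ext_lin_eq (W : lmodType K) (f h : {linear ext -> W}) :
  (forall x, f (wedge x) = h (wedge x)) -> f = h.
Proof.
move=> fh; apply: linP; apply: ext_ind => [|a x X IH]; first by rewrite !linear0.
by rewrite !linearP fh IH.
Qed.

Section Lift.
Context {W : lmodType K} (f : altmap W).

HB.instance Definition _ :=
  GRing.isZmodMorphism.Build {freeg (n.-tuple g) / K} W (fglift f)
    (lift_is_additive f).

Lemma fgliftZ a D : fglift f (a *: D) = a *: fglift f D.
Proof.
rewrite -[D in RHS]freeg_sumE [a *: D]/(fgscale a D) /fgscale !raddf_sum.
apply: eq_bigr => x _.
by rewrite /= !liftU scalerA.
Qed.

Lemma fglift_rel D : ext_rel D -> fglift f D = 0.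
Proof.
elim=> {D} [|a D E _ hD _ hE|x i a u v|x i j ij xij].
- exact: raddf0.
- by rewrite raddfD /= fgliftZ hD hE scaler0 addr0.
- by rewrite raddfB raddfD /= fgliftZ !liftU !scale1r alt_linear subrr.
- by rewrite liftU scale1r (alt_eq0 f ij xij).
Qed.

Definition lift_fun (X : ext) : W := fglift f (repr X).

Lemma lift_fun_pi D : lift_fun (ext_pi D) = fglift f D.
Proof.
apply/eqP; rewrite -subr_eq0 -raddfB; apply/eqP/fglift_rel/ext_piP.
exact: ext_piK.
Qed.

Fact lift_fun_linear a X Y : lift_fun (a *: X + Y) = a *: lift_fun X + lift_fun Y.
Proof.
rewrite -[X]ext_piK -[Y]ext_piK -ext_pi_lin !lift_fun_pi.
by rewrite raddfD /= fgliftZ.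
Qed.

(* The universal property of the exterior power, see also [ext_lin_eq]. *)
Definition ext_lift : {linear ext -> W} := LinMap lift_fun_linear.

Lemma ext_liftE x : ext_lift (wedge x) = f x.
Proof. by rewrite [LHS]lift_fun_pi liftU scale1r. Qed.

End Lift.
End Power.

Lemma tnth_tupd n (x : n.-tuple g) i u j :
  tnth (tupd x i u) j = if j == i then u else tnth x j.
Proof. by rewrite tnth_mktuple. Qed.

Lemma tupd_id n (x : n.-tuple g) i : tupd x i (tnth x i) = x.
Proof. by apply: eq_from_tnth => j; rewrite tnth_tupd; case: eqP => // ->. Qed.

Lemma tupd_tupd n (x : n.-tuple g) i u v : tupd (tupd x i u) i v = tupd x i v.
Proof. by apply: eq_from_tnth => j; rewrite !tnth_tupd; case: eqP. Qed.

Lemma tupdC n (x : n.-tuple g) i j u v : i != j ->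
  tupd (tupd x i u) j v = tupd (tupd x j v) i u.
Proof.
move=> ij; apply: eq_from_tnth => l; rewrite !tnth_tupd.
by have [->|//] := eqVneq l j; rewrite eq_sym (negPf ij).
Qed.

Lemma map_tupd (f : g -> g) n (x : n.-tuple g) i u :
  map_tuple f (tupd x i u) = tupd (map_tuple f x) i (f u).
Proof.
apply: eq_from_tnth => j; rewrite !(tnth_map, tnth_tupd).
by case: ifP.
Qed.

Lemma wedge_tupdC n (x : n.-tuple g) i j u v : i != j ->
  wedge (tupd (tupd x i u) j v) = - wedge (tupd (tupd x i v) j u).
Proof.
move=> ij; set w := fun u v => wedge (tupd (tupd x i u) j v).
have wD2 a b c : w a (b + c) = w a b + w a c.
  by rewrite /w -[b]scale1r wedge_linear !scale1r.
have wD1 a b c : w (b + c) a = w b a + w c a.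
  rewrite /w !(tupdC _ _ _ ij) -[b]scale1r wedge_linear !scale1r.
  by [].
have w0 a : w a a = 0.
  by apply: (wedge_eq0 ij); rewrite !tnth_tupd (negPf ij) !eqxx.
have := w0 (u + v); rewrite wD2 !wD1 !w0 add0r addr0 addrC.
by move/eqP; rewrite addr_eq0 => /eqP.
Qed.

(* x_1 /\ ... /\ x_n |-> alpha x_1 /\ ... /\ alpha x_n *)
Section Map.
Variables (n : nat) (alpha : {linear g -> g}).

Definition map_fun (x : n.-tuple g) : ext n := wedge (map_tuple alpha x).

Fact map_fun_linear x i a u v :
  map_fun (tupd x i (a *: u + v)) =
  a *: map_fun (tupd x i u) + map_fun (tupd x i v).
Proof. by rewrite /map_fun !map_tupd linearP wedge_linear. Qed.

Fact map_fun_eq0 x i j : i != j -> tnth x i = tnth x j -> map_fun x = 0.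
Proof. by move=> ij xij; apply: (wedge_eq0 ij); rewrite !tnth_map xij. Qed.

Definition ext_map : {linear ext n -> ext n} :=
  ext_lift (AltMap map_fun_linear map_fun_eq0).

Lemma ext_mapE x : ext_map (wedge x) = wedge (map_tuple alpha x).
Proof. exact: ext_liftE. Qed.

End Map.

(* (x_1 /\ ... /\ x_n, y) |-> x_1 /\ ... /\ x_n /\ y *)
Section Snoc.
Variables (n : nat).

Definition snoc_fun (y : g) (x : n.-tuple g) : ext n.+1 :=
  wedge [tuple of rcons x y].

Lemma rcons_tupd (x : n.-tuple g) i u y :
  [tuple of rcons (tupd x i u) y] =
  tupd [tuple of rcons x y] (widen_ord (leqnSn n) i) u.
Proof.
have sz (t : n.-tuple g) : size t = n := size_tuple t.
apply: eq_from_tnth => j; rewrite tnth_tupd !(tnth_nth 0) !nth_rcons !sz.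
rewrite -val_eqE /=; case: ltnP => [jn|nj].
  have nthE (t : n.-tuple g) : nth 0 t j = tnth t (Ordinal jn).
    by rewrite (tnth_nth 0).
  by rewrite (nthE (tupd x i u)) (nthE x) tnth_tupd -val_eqE.
have /negPf -> // : j != i :> nat.
by rewrite neq_ltn (leq_trans (ltn_ord i) nj) orbT.
Qed.

Lemma rcons_tupd_max (x : n.-tuple g) y :
  [tuple of rcons x y] = tupd [tuple of rcons x 0] ord_max y.
Proof.
apply: eq_from_tnth => j; rewrite tnth_tupd !(tnth_nth 0) /= !nth_rcons.
rewrite !size_tuple -val_eqE /=; have := ltn_ord j; rewrite ltnS.
by case: ltngtP.
Qed.

Fact snoc_linear y x i a u v :
  snoc_fun y (tupd x i (a *: u + v)) =
  a *: snoc_fun y (tupd x i u) + snoc_fun y (tupd x i v).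
Proof. by rewrite /snoc_fun !rcons_tupd wedge_linear. Qed.

Fact snoc_eq0 y x i j : i != j -> tnth x i = tnth x j -> snoc_fun y x = 0.
Proof.
move=> ij xij.
apply: (@wedge_eq0 _ _ (widen_ord (leqnSn n) i) (widen_ord (leqnSn n) j)) => //.
rewrite !(tnth_nth 0) /= !nth_rcons !size_tuple !ltn_ord.
by rewrite -!tnth_nth.
Qed.

Definition snoc_lift y : {linear ext n -> ext n.+1} :=
  ext_lift (AltMap (snoc_linear y) (@snoc_eq0 y)).

Fact snoc_lift_linear X a u v :
  snoc_lift (a *: u + v) X = a *: snoc_lift u X + snoc_lift v X.
Proof.
suff -> : snoc_lift (a *: u + v) = a *: snoc_lift u + snoc_lift v by [].
apply: ext_lin_eq => x; rewrite lin_addE lin_scaleE !ext_liftE /= /snoc_fun.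
by rewrite rcons_tupd_max wedge_linear -!rcons_tupd_max.
Qed.

Definition ext_snoc (X : ext n) : {linear g -> ext n.+1} :=
  LinMap (snoc_lift_linear X).

Lemma ext_snocE x y : ext_snoc (wedge x) y = wedge [tuple of rcons x y].
Proof. exact: ext_liftE. Qed.

Lemma ext_snoc_linear a X Y y :
  ext_snoc (a *: X + Y) y = a *: ext_snoc X y + ext_snoc Y y.
Proof. exact: linearP. Qed.

End Snoc.

(* y_1 /\ ... /\ y_n |->
   \sum_i alpha y_1 /\ ... /\ d y_i /\ ... /\ alpha y_n *)
Section Derivation.
Variables (n : nat) (alpha d : {linear g -> g}).

Definition der_fun (y : n.-tuple g) : ext n :=
  \sum_(i < n) wedge (tupd (map_tuple alpha y) i (d (tnth y i))).

Fact der_fun_linear x j a u v :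
  der_fun (tupd x j (a *: u + v)) =
  a *: der_fun (tupd x j u) + der_fun (tupd x j v).
Proof.
rewrite /der_fun scaler_sumr -big_split /=; apply: eq_bigr => i _.
rewrite !map_tupd !tnth_tupd; have [->|ij] := eqVneq i j.
  by rewrite !tupd_tupd linearP wedge_linear.
by rewrite eq_sym in ij; rewrite !(tupdC _ _ _ ij) linearP wedge_linear.
Qed.

Fact der_fun_eq0 x p q : p != q -> tnth x p = tnth x q -> der_fun x = 0.
Proof.
move=> pq xpq; have qp : q != p by rewrite eq_sym.
rewrite /der_fun (bigD1 p) // (bigD1 q) //= big1 ?addr0 => [|i /andP[ip iq]].
  rewrite -xpq; set y := map_tuple alpha x; set e := d _.
  have yp : y = tupd y p (alpha (tnth x p)) by rewrite -tnth_map tupd_id.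
  have yq : y = tupd y q (alpha (tnth x p)) by rewrite xpq -tnth_map tupd_id.
  rewrite {1}yq {2}yp (tupdC _ _ _ qp) (wedge_tupdC _ _ _ pq).
  by rewrite addNr.
apply: (wedge_eq0 pq); rewrite !tnth_tupd ![_ == i]eq_sym (negPf ip) (negPf iq).
by rewrite !tnth_map xpq.
Qed.

Definition ext_der : {linear ext n -> ext n} :=
  ext_lift (AltMap der_fun_linear der_fun_eq0).

Lemma ext_derE y : ext_der (wedge y) =
  \sum_(i < n) wedge (tupd (map_tuple alpha y) i (d (tnth y i))).
Proof. exact: ext_liftE. Qed.

End Derivation.
End Exterior.

Arguments ext {K} g n.

(* An n-Hom-Lie algebra of arity n = k + 2: the natural number k ranges over all
   n >= 2, with n - 1 = k.+1 and n - 2 = k. The automorphism [alpha] is [twist]. *)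
Record nHomLie (K : fieldType) (k : nat) (g : lmodType K) := NHomLie {
  br : {linear ext g k.+2 -> g};
  twist : GL g;
  twist_br : forall x : k.+2.-tuple g,
    twist (br (wedge x)) = br (wedge (map_tuple twist x));
  hom_Filippov : forall (x : k.+1.-tuple g) (y : k.+2.-tuple g),
    br (wedge [tuple of rcons (map_tuple twist x) (br (wedge y))]) =
    \sum_(i < k.+2)
      br (wedge (tupd (map_tuple twist y) i
                      (br (wedge [tuple of rcons x (tnth y i)])))) }.

Section Representation.
Context {K : fieldType} {k : nat} {g : lmodType K} (A : nHomLie k g).
Local Notation alpha := (twist A).

Definition ad (X : ext g k.+1) : {linear g -> g} := br A \o ext_snoc X.

(* [X, Y]_F *)
Definition brF (X Y : ext g k.+1) : ext g k.+1 := ext_der k.+1 alpha (ad X) Y.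

Lemma brFE (x y : k.+1.-tuple g) :
  brF (wedge x) (wedge y) =
  \sum_(i < k.+1)
    wedge (tupd (map_tuple alpha y) i
                (br A (wedge [tuple of rcons x (tnth y i)]))).
Proof.
by rewrite /brF ext_derE; apply: eq_bigr => i _; rewrite /= ext_snocE.
Qed.

Lemma brF_linearl a X X' Y : brF (a *: X + X') Y = a *: brF X Y + brF X' Y.
Proof.
rewrite /brF; set D := ext_der _ _.
suff -> : D (ad (a *: X + X')) = a *: D (ad X) + D (ad X') by [].
apply: ext_lin_eq => y; rewrite lin_addE lin_scaleE !ext_derE.
rewrite scaler_sumr -big_split; apply: eq_bigr => i _ /=.
by rewrite ext_snoc_linear linearP wedge_linear.
Qed.

Lemma brF_linearr X a Y Y' : brF X (a *: Y + Y') = a *: brF X Y + brF X Y'.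
Proof. exact: linearP. Qed.

(* With 0-based i, the sign (-1)^(n - i) reads (-1)^(k.+2 - i.+1). *)
Record is_representation (V : lmodType K)
    (rho : {linear ext g k.+1 -> {linear V -> V}}) (beta : GL V) : Prop := {
  rep_twist : forall X v,
    rho (ext_map k.+1 alpha X) (beta v) = beta (rho X v);
  rep_brF : forall X Y v,
    rho (ext_map k.+1 alpha X) (rho Y v) - rho (ext_map k.+1 alpha Y) (rho X v)
    = rho (brF X Y) (beta v);
  rep_br : forall (x : k.-tuple g) (y : k.+2.-tuple g) v,
    rho (wedge [tuple of rcons (map_tuple alpha x) (br A (wedge y))]) (beta v)
    = \sum_(i < k.+2) (-1) ^+ (k.+2 - i.+1) *:
        rho (wedge [tuple alpha (tnth y (fintype.lift i j)) | j < k.+1])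
          (rho (wedge [tuple of rcons x (tnth y i)]) v) }.

Section Dual.
Context {V : lmodType K}.
Variables (rho : {linear ext g k.+1 -> {linear V -> V}}) (beta : GL V).

Fact dual_rho_linear a X Y :
  - transpose (rho (a *: X + Y)) =
  a *: - transpose (rho X) - transpose (rho Y).
Proof.
apply: linP => xi; apply: linP => u.
change (- xi (rho (a *: X + Y) u) = a *: - xi (rho X u) - xi (rho Y u)).
by rewrite linearP lin_addE lin_scaleE linearP opprD scalerN.
Qed.

(* rho^* *)
Definition dual_rho : {linear ext g k.+1 -> {linear dual V -> dual V}} :=
  LinMap dual_rho_linear.

Lemma dual_rhoE X xi u : dual_rho X xi u = - xi (rho X u).
Proof. by []. Qed.

(* The transpose of beta^-2. *)
Definition betaV2T : {linear dual V -> dual V} :=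
  transpose (gl_inv beta \o gl_inv beta).

Definition star_rho_fun (X : ext g k.+1) : {linear dual V -> dual V} :=
  dual_rho (ext_map k.+1 alpha X) \o betaV2T.

Fact star_rho_linear a X Y :
  star_rho_fun (a *: X + Y) = a *: star_rho_fun X + star_rho_fun Y.
Proof.
by apply: linP => xi; rewrite /star_rho_fun !linearP.
Qed.

(* rho^\star *)
Definition star_rho : {linear ext g k.+1 -> {linear dual V -> dual V}} :=
  LinMap star_rho_linear.

Lemma star_rhoE X xi :
  star_rho X xi = dual_rho (ext_map k.+1 alpha X) (betaV2T xi).
Proof. by []. Qed.

End Dual.
End Representation.

(* Main.v *)
(* Conditions (i) and (ii) for rho^star follow from those for rho, since
   beta^-1 rho(alpha X) = rho(X) beta^-1. Condition (iii) for rho^star amounts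
   to A + B = 0, where, up to signs,
     A = sum_i rho(alpha(y_1, .., ^y_i, .., y_n)) rho(x, y_i)  and
     B = sum_i rho(alpha(x, y_i)) rho(y_1, .., ^y_i, .., y_n).
   Put m = n - 1 and fix 2m letters in g. For a set S of m letters let f(S) be
   rho(alpha S) rho(S^c) times the sign of the shuffle (S, S^c), and let psi be
   the sum of f and of the same expression with both factors exchanged.
   Expanding rho([X, Y]_F) in (ii) by means of (iii) gives U D psi = 0 on sets
   of size m, where D and U sum over all ways of removing (resp. adding) a
   letter. They generate an sl_2 acting on functions on the Boolean lattice, so
   in characteristic 0 the operator U is injective on functions on sets of size
   m + 1. Hence D psi = 0, which is A + B = 0. *)
Require Import Defs.
From mathcomp Require Import all_boot all_order all_fingroup all_algebra.
From mathcomp Require Import zify boolp.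

Set Implicit Arguments.
Unset Strict Implicit.
Unset Printing Implicit Defensive.

Import GRing.Theory.
Local Open Scope ring_scope.

(** * Adding and removing elements on the Boolean lattice *)

Section BooleanLattice.
Variables (T : finType) (W : zmodType).
Implicit Types (f : {set T} -> W) (S : {set T}).

Definition down f S := \sum_(j in S) f (S :\ j).
Definition up f S := \sum_(i in ~: S) f (i |: S).

Lemma down_setU1 f S i : i \notin S ->
  down f (i |: S) = f S + \sum_(j in S) f ((i |: S) :\ j).
Proof. by move=> iS; rewrite /down big_setU1 //= setU1K. Qed.

(** The sl_2 commutation relation. Adding i and removing j commute for i <> j, so only the terms
    with i = j remain: one for each i outside S and one for each j in S. *)
Lemma up_down f S :
  up (down f) S = down (up f) S + f S *+ #|~: S| - f S *+ #|S|.
Proof.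
apply/eqP; rewrite eq_sym subr_eq eq_sym; apply/eqP.
have -> : up (down f) S =
    f S *+ #|~: S| + \sum_(i in ~: S) \sum_(j in S) f ((i |: S) :\ j).
  rewrite -sumr_const -big_split; apply: eq_bigr => i.
  by rewrite inE => iS; rewrite down_setU1.
have -> : down (up f) S =
    f S *+ #|S| + \sum_(j in S) \sum_(i in ~: S) f ((i |: S) :\ j).
  rewrite -sumr_const -big_split; apply: eq_bigr => j jS.
  have CE : ~: (S :\ j) = j |: ~: S by rewrite setDE setCI setCK setUC.
  rewrite /up CE big_setU1 ?inE ?jS //= setD1K //; congr (_ + _).
  apply: eq_bigr => i; rewrite inE => iS; congr f.
  apply/setP => l; rewrite !inE; have [->|] := eqVneq l i; rewrite ?orbT //=.
  by rewrite andbT; apply/esym; apply: contraNneq iS => ->.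
by rewrite exchange_big /= [LHS]addrC -[RHS]addrA; congr (_ + _); rewrite addrC.
Qed.

Hypothesis torsion_free : forall (v : W) n, v *+ n.+1 = 0 -> v = 0.

(* On sets of size m + j, [up] maps D^j f to -j(j+1) D^(j-1) f with D = [down],
   and D^j f vanishes for large j; descending induction on j. *)
Lemma up_inj m f : #|T| = (m + m)%N ->
    (forall S, #|S| = m -> up f S = 0) ->
  forall S, #|S| = m.+1 -> f S = 0.
Proof.
move=> cardT upf0.
have upE j S : #|S| = (m + j)%N ->
    up (iter j down f) S = - (iter j.-1 down f S *+ (j * j.+1)).
  elim: j S => [|j IH] S; first by rewrite addn0 mulr0n oppr0 => /upf0.
  move=> cS; rewrite iterS up_down.
  have -> : down (up (iter j down f)) S = - (iter j down f S *+ (j * j.+1)).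
    rewrite {1}/down.
    rewrite (eq_bigr (fun i => - (iter j.-1 down f (S :\ i) *+ (j * j.+1)))).
      (* For j = 0 the predecessor [j.-1] is again 0, but the multiplicity 0 kills the term. *)
      rewrite sumrN sumrMnl -/(down _ S); case: j {IH cS} => [|j].
        by rewrite !mulr0n.
      by rewrite -iterS.
    by move=> i iS; rewrite IH //; move: cS; rewrite (cardsD1 i S) iS; lia.
  have cC : (#|S| + #|~: S| = m + m)%N by rewrite cardsC.
  (* S exceeds its complement by 2(j + 1), and j(j + 1) + 2(j + 1) = (j + 1)(j + 2). *)
  have -> : #|S| = (#|~: S| + j.+1.*2)%N by lia.
  rewrite mulrnDr opprD addrA addrK -opprD -mulrnDr /=; congr (- (_ *+ _)).
  by nia.
(* [d] bounds the distance from j up to m; at d = 0 a set of size m + 1 + j would have more than 2m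
   elements. *)
suff H d j S : (m <= j + d)%N -> #|S| = (m.+1 + j)%N -> iter j down f S = 0.
  by move=> S cS; apply: (H m 0%N) => //; rewrite ?addn0.
elim: d j S => [|d IH] j S le cS.
  by have := max_card (mem S); rewrite cS cardT; lia.
have /= := upE j.+1 S; rewrite cS addSnnS => /(_ erefl).
rewrite /up big1 => [|i].
  by move/esym/eqP; rewrite oppr_eq0 => /eqP; apply: torsion_free.
rewrite inE => iS; apply: (IH j.+1); first by lia.
by rewrite cardsU1 iS cS; lia.
Qed.

(** Exchanging a point of [S :\: L] with one of [L :\: S] brings S closer to L. *)
Lemma perm_imset_card (L S : {set T}) : #|L| = #|S| ->
  exists s : {perm T}, s @: L = S.
Proof.
have [n] := ubnP #|S :\: L|; elim: n S => // n IH S; rewrite ltnS => le cS.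
have [/eqP|[a]] := set_0Vmem (S :\: L).
  rewrite setD_eq0 => SL; exists 1%g.
  rewrite (eq_imset (g := id)) ?imset_id => [|x]; last exact: perm1.
   apply/esym/eqP.
  by rewrite eqEcard SL cS leqnn.
rewrite inE => /andP[aL aS].
have [/eqP|[b]] := set_0Vmem (L :\: S).
  rewrite setD_eq0 => LS.
  have /eqP LE : L == S by rewrite eqEcard LS cS leqnn.
  by rewrite LE aS in aL.
rewrite inE => /andP[bS bL].
have [||s sE] := IH (tperm a b @: S).
- have : (tperm a b @: S) :\: L \proper S :\: L.
    apply/properP; split.
      apply/subsetP => x; rewrite !inE => /andP[xL /imsetP[y yS xE]].
      rewrite xL /= xE; case: tpermP yS xE => [->|->|//] //.
        by move=> _ xb; rewrite xb bL in xL.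
    exists a; first by rewrite !inE aL aS.
    rewrite !inE aL /=; apply/imsetP => -[y yS].
    case: tpermP yS => [_ _ E|-> bS'|ya _ _ E]; first by rewrite E bL in aL.
      by rewrite bS' in bS.
    exact: ya.
  by move/proper_card => /leq_trans; apply.
- by rewrite card_imset //; apply: perm_inj.
exists (s * tperm a b)%g.
have -> : (s * tperm a b)%g @: L = tperm a b @: (s @: L).
  by rewrite -imset_comp; apply: eq_imset => x; rewrite permM.
rewrite sE -imset_comp (eq_imset (g := id)) ?imset_id // => x /=.
exact: tpermK.
Qed.

(** * Functions on permutations that depend only on the image of a fixed set *)

Section Young.
Variables (L : {set T}) (theta : {perm T} -> W).
(** In [tperm a b * s] the transposition acts first, so this is invariance under the Young subgroup
    of L and its complement. *)
Hypothesis theta_same : forall a b s,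
  (a \in L) = (b \in L) -> theta (tperm a b * s)%g = theta s.

(* Two such permutations differ by transpositions within L and within its
   complement; induct on the number of points where they differ. *)
Lemma theta_imset (s t : {perm T}) : s @: L = t @: L -> theta s = theta t.
Proof.
have [n] := ubnP #|[set x | s x != t x]|; elim: n s => // n IH s.
rewrite ltnS => le st.
have [x sx|all] := pickP [pred x | s x != t x]; last first.
  congr theta; apply/permP => x; apply/eqP; exact/negbFE/all.
(* Since s and t have the same image of L, x and y lie on the same side; precomposing s with
   [tperm x y] makes it agree with t at x and spoils no other agreement. *)
have [y yE] : exists y, s y = t x by exists ((s^-1)%g (t x)); rewrite permKV.
have memL (u : {perm T}) z : (u z \in u @: L) = (z \in L).
  by rewrite mem_imset //; apply: perm_inj.
have xy : (x \in L) = (y \in L) by rewrite -(memL t) -(memL s) yE st.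
rewrite -(theta_same s xy); apply: IH.
  apply: leq_trans le; apply: proper_card; apply/properP; split.
    apply/subsetP => z; rewrite !inE permM.
    case: tpermP => [->|->|//]; first by rewrite yE eqxx.
    move=> _; apply: contraNneq sx => E.
    have /perm_inj E' : t x = t y by rewrite -yE.
    by rewrite {1}E' yE.
  by exists x; rewrite !inE ?permM ?tpermL ?yE ?eqxx //.
rewrite -st -[in RHS](_ : tperm x y @: L = L).
  by rewrite -imset_comp; apply: eq_imset => z; rewrite permM.
apply/eqP; rewrite eqEcard card_imset ?leqnn ?andbT; last exact: perm_inj.
apply/subsetP => z /imsetP[u uL ->].
by case: tpermP uL => [->|->|//]; rewrite xy.
Qed.

Hypothesis cardLC : #|L| = #|~: L|.
Hypothesis theta_sum0 : forall s,
  \sum_(i in ~: L) (theta s + \sum_(p in L) theta (tperm p i * s)%g) = 0.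

(** Let f be [theta] read as a function of the image of L. The exchange sum is D f at that image
    with [s i] added, and the hypothesis says U D f = 0, so [up_inj] applies to D f. *)
Lemma theta_exchange0 s i : i \in ~: L ->
  theta s + \sum_(p in L) theta (tperm p i * s)%g = 0.
Proof.
(* The default is taken only when S and L differ in size, and such values of f never enter. *)
pose f S := theta (odflt 1%g [pick u : {perm T} | u @: L == S]).
have fE (u : {perm T}) : f (u @: L) = theta u.
  rewrite /f; case: pickP => [t /eqP tu|/(_ u)]; first exact: theta_imset.
  by rewrite eqxx.
have memL (u : {perm T}) z : (u z \in u @: L) = (z \in L).
  by rewrite mem_imset //; apply: perm_inj.
have downE (u : {perm T}) j : j \in ~: L -> down f (u j |: u @: L) =
    theta u + \sum_(p in L) theta (tperm p j * u)%g.
  rewrite inE => jL; rewrite down_setU1 ?memL // fE; congr (_ + _).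
  rewrite big_imset /=; last by move=> ? ? _ _; apply: perm_inj.
  apply: eq_bigr => p pL; rewrite -fE; congr f.
  apply/setP => z; rewrite -[z](permKV u); move: (u^-1 z)%g => y.
  have -> : (tperm p j * u)%g @: L = u @: (tperm p j @: L).
    by rewrite -imset_comp; apply: eq_imset => x; rewrite permM.
  rewrite (mem_imset _ _ (@perm_inj _ u)) !inE !(inj_eq perm_inj) memL.
  rewrite -[y in RHS](tpermK p j) (mem_imset _ _ (@perm_inj _ (tperm p j))).
  have pj : p != j by apply: contraNneq jL => <-.
  case: tpermP => [->|->|/eqP yp /eqP yj].
  - by rewrite eqxx (negPf jL).
  - by rewrite eqxx eq_sym pj pL.
  - by rewrite (negPf yp) (negPf yj).
have updown0 S : #|S| = #|L| -> up (down f) S = 0.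
  case/esym/perm_imset_card => u <-; rewrite -[RHS](theta_sum0 u) /up.
  have -> : ~: (u @: L) = u @: ~: L.
    apply/setP => z; rewrite -[z](permKV u) inE memL mem_imset ?inE //.
    exact: perm_inj.
  rewrite big_imset /=; last by move=> ? ? _ _; apply: perm_inj.
  by apply: eq_bigr => j jL; rewrite downE.
move=> iL; rewrite -downE //; apply: (up_inj _ updown0).
  by rewrite {2}cardLC cardsC.
rewrite cardsU1 memL; move: iL; rewrite inE => -> /=.
by rewrite card_imset //; apply: perm_inj.
Qed.

End Young.

End BooleanLattice.

(** * Exchange relations for alternating functions of letters *)

Section Exchange.
Variables (K : fieldType) (W : lmodType K) (U : Type).
Hypothesis charK0 : [pchar K] =i pred0.

(* psi times the sign of s, at w o s, depends only on the image of L by s. *)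
Lemma alt_exchange0 (T : finType) (L : {set T}) (psi : (T -> U) -> W) :
    #|L| = #|~: L| ->
    (forall w a b, a != b -> (a \in L) = (b \in L) ->
      psi (w \o tperm a b) = - psi w) ->
    (forall w, \sum_(i in ~: L)
      (psi w - \sum_(p in L) psi (w \o tperm p i)) = 0) ->
  forall w i, i \in ~: L -> psi w - \sum_(p in L) psi (w \o tperm p i) = 0.
Proof.
move=> cardL psi_same psi_sum0 w i iL.
pose theta (s : {perm T}) := (-1) ^+ s *: psi (w \o s).
have compE a b (s : {perm T}) : w \o (tperm a b * s)%g = (w \o s) \o tperm a b.
  by apply: funext => z /=; rewrite permM.
have thetaE s j : j \in ~: L ->
    theta s + \sum_(p in L) theta (tperm p j * s)%g =
    (-1) ^+ s *: (psi (w \o s) - \sum_(p in L) psi ((w \o s) \o tperm p j)).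
  rewrite inE => jL; rewrite scalerBr scaler_sumr -sumrN; congr (_ + _).
  apply: eq_bigr => p pL; rewrite /theta odd_permM odd_tperm.
  have -> : p != j by apply: contraNneq jL => <-.
  by rewrite compE addTb signrN scaleNr.
have /(_ 1%g i iL) : forall s j, j \in ~: L ->
    theta s + \sum_(p in L) theta (tperm p j * s)%g = 0.
  apply: theta_exchange0 => //.
  - move=> v n /eqP; rewrite -scaler_nat scaler_eq0 (proj1 (pcharf0P K) charK0).
    by case/orP=> // /eqP.
  - move=> a b s ab; rewrite /theta odd_permM odd_tperm compE.
    have [->|nab] := eqVneq a b; last first.
      by rewrite psi_same // addTb signrN scalerN scaleNr opprK.
    rewrite addFb tperm1; congr (_ *: psi _).
    by apply: funext => z /=; rewrite perm1.
  - move=> s; rewrite (eq_bigr _ (thetaE s)) -scaler_sumr psi_sum0.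
    by rewrite scaler0.
rewrite thetaE // odd_perm1 scale1r.
suff -> : w \o (1%g : {perm T}) = w by [].
by apply: funext => z /=; rewrite perm1.
Qed.

Definition swap m (x : 'I_m + 'I_m) : 'I_m + 'I_m :=
  match x with inl i => inr i | inr i => inl i end.

Lemma swapK m : involutive (@swap m).
Proof. by case. Qed.

Lemma swap_tperm m a b :
  @swap m \o tperm a b = tperm (swap a) (swap b) \o @swap m.
Proof.
apply: funext => z /=; rewrite -(inj_tperm _ _ _ (can_inj (@swapK m))).
by [].
Qed.

(* The hypothesis at w and at its swap add up to a relation on the symmetrised
   function, to which [alt_exchange0] applies. *)
Lemma bipartite_exchange0 m (Phi : ('I_m + 'I_m -> U) -> W) :
    (forall w a b, a != b -> Phi (w \o tperm (inl a) (inl b)) = - Phi w) ->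
    (forall w a b, a != b -> Phi (w \o tperm (inr a) (inr b)) = - Phi w) ->
    (forall w, Phi w - Phi (w \o @swap m) =
       \sum_i (Phi w - \sum_p Phi (w \o tperm (inl p) (inr i)))) ->
  forall w i,
    Phi w - \sum_p Phi (w \o tperm (inl p) (inr i)) +
    (Phi (w \o @swap m) -
     \sum_p Phi (w \o tperm (inl p) (inr i) \o @swap m)) = 0.
Proof.
move=> altl altr PhiB w i.
pose psi u := Phi u + Phi (u \o @swap m).
pose L : {set 'I_m + 'I_m} := [set inl a | a in 'I_m].
have inl_inj : injective (@inl 'I_m 'I_m) by move=> a b [].
have inr_inj : injective (@inr 'I_m 'I_m) by move=> a b [].
have Ll a : inl a \in L by apply: imset_f.
have Lr a : inr a \notin L by apply/imsetP => -[].
have LC : ~: L = [set inr a | a in 'I_m].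
  apply/setP => -[a|a]; rewrite inE ?Ll ?Lr /=.
    by apply/esym/negbTE/imsetP => -[].
  by apply/esym/imset_f.
have swapE (u : 'I_m + 'I_m -> U) a b :
    u \o tperm a b \o @swap m = u \o @swap m \o tperm (swap a) (swap b).
  rewrite -[LHS]compA.
  rewrite -[tperm a b in LHS](_ : tperm (swap (swap a)) (swap (swap b)) = _).
    by rewrite -swap_tperm.
  by rewrite !swapK.
suff : psi w - \sum_(p in L) psi (w \o tperm p (inr i)) = 0.
  rewrite big_imset /= => [|? ? _ _]; last exact: inl_inj.
  by rewrite big_split opprD addrACA.
apply: alt_exchange0; last by rewrite inE Lr.
- by rewrite LC !card_imset.
- move=> u [a|a] [b|b] ab; rewrite ?Ll ?(negPf (Lr _)) // => _;
    rewrite /psi swapE /= opprD.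
    by rewrite altl ?altr // -(inj_eq inl_inj).
  by rewrite altl ?altr // -(inj_eq inr_inj).
move=> u; rewrite LC big_imset /= => [|? ? _ _]; last exact: inr_inj.
transitivity (\sum_j (Phi u - \sum_p Phi (u \o tperm (inl p) (inr j))) +
  \sum_j (Phi (u \o @swap m) -
          \sum_p Phi (u \o @swap m \o tperm (inl p) (inr j)))); last first.
  rewrite -!PhiB.
  have -> : u \o @swap m \o @swap m = u by apply: funext => z /=; rewrite swapK.
  by rewrite addrC subrKA subrr.
rewrite [X in _ = _ + X]sumrB.
(* The swap turns the exchange of [inl p] and [inr j] into that of [inl j] and [inr p], so only the
   double sums agree, with p and j interchanged. *)
have -> : \sum_j \sum_p Phi (u \o @swap m \o tperm (inl p) (inr j)) =
          \sum_j \sum_p Phi (u \o tperm (inl p) (inr j) \o @swap m).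
  rewrite exchange_big /=; apply: eq_bigr => p _; apply: eq_bigr => j _.
  by rewrite swapE /= tpermC.
rewrite -sumrB -big_split; apply: eq_bigr => j _ /=.
rewrite big_imset /= => [|? ? _ _]; last exact: inl_inj.
by rewrite big_split opprD addrACA.
Qed.

End Exchange.

(** * Signs of permuted wedges and omitted letters *)

Section Wedge.
Context {K : fieldType} {g : lmodType K}.

Lemma wedge_tperm n (w : 'I_n -> g) a b : a != b ->
  wedge [tuple w (tperm a b i) | i < n] = - wedge [tuple w i | i < n].
Proof.
move=> ab; set x := [tuple w i | i < n].
rewrite -[x in RHS](tupd_id x a) -[tupd x a _ in RHS](tupd_id _ b).
rewrite wedge_tupdC // opprK; congr wedge; apply: eq_from_tnth => i.
rewrite !tnth_tupd !tnth_mktuple. rewrite [b == a]eq_sym (negPf ab).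
case: tpermP => [->|->|/eqP ia /eqP ib]; rewrite ?eqxx //.
  by rewrite (negPf ab).
by rewrite (negPf ia) (negPf ib).
Qed.

Lemma wedge_perm n (s : 'S_n) (w : 'I_n -> g) :
  wedge [tuple w (s i) | i < n] = (-1) ^+ s *: wedge [tuple w i | i < n].
Proof.
have [ts -> dts] := prod_tpermP s; rewrite odd_perm_prod //.
elim: ts dts w => [_|[a b] ts IH /= /andP[ab dts]] w.
  rewrite big_nil scale1r; congr wedge; apply: eq_from_tnth => i.
  by rewrite !tnth_mktuple perm1.
rewrite big_cons /= signrN scaleNr -IH // -(wedge_tperm (fun i => w (_ i)) ab).
congr wedge; apply: eq_from_tnth => i.
by rewrite !tnth_mktuple permM.
Qed.

Definition init_tuple n (y : n.+1.-tuple g) : n.-tuple g :=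
  [tuple tnth y (widen_ord (leqnSn n) j) | j < n].

Lemma tnth_rcons_widen n (x : n.-tuple g) z j :
  tnth [tuple of rcons x z] (widen_ord (leqnSn n) j) = tnth x j.
Proof. by rewrite !(tnth_nth 0) /= nth_rcons size_tuple ltn_ord. Qed.

Lemma tnth_rcons_max n (x : n.-tuple g) z :
  tnth [tuple of rcons x z] ord_max = z.
Proof. by rewrite (tnth_nth 0) /= nth_rcons size_tuple ltnn eqxx. Qed.

Lemma init_rcons n (x : n.-tuple g) z : init_tuple [tuple of rcons x z] = x.
Proof.
by apply: eq_from_tnth => j; rewrite tnth_mktuple tnth_rcons_widen.
Qed.

Lemma rcons_init n (y : n.+1.-tuple g) :
  [tuple of rcons (init_tuple y) (tnth y ord_max)] = y.
Proof.
apply: eq_from_tnth => j; have [->|nj] := eqVneq j ord_max.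
  by rewrite tnth_rcons_max.
have jn : (j < n)%N by rewrite ltn_neqAle -ltnS ltn_ord andbT -val_eqE in nj *.
have -> : j = widen_ord (leqnSn n) (Ordinal jn) by apply: val_inj.
by rewrite tnth_rcons_widen tnth_mktuple.
Qed.

(* Moving the last entry into the gap is a cycle: it absorbs the sign
   (-1)^(n - i) of the definition of a representation. *)
Lemma wedge_omit k (y : k.+2.-tuple g) (p : 'I_k.+1) :
  (-1) ^+ (k.+2 - p.+1) *:
     wedge [tuple tnth y (fintype.lift (widen_ord (leqnSn _) p) j) | j < k.+1] =
  - wedge (tupd (init_tuple y) p (tnth y ord_max)).
Proof.
set z := tnth y ord_max; set x := init_tuple y.
have := wedge_perm (lift_perm ord_max p 1%g) (tnth (tupd x p z)).
have -> : [tuple tnth (tupd x p z) i | i < k.+1] = tupd x p z.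
  by apply: eq_from_tnth => i; rewrite tnth_mktuple.
rewrite odd_lift_perm odd_perm1 addbF /= => E.
have -> : [tuple tnth y (fintype.lift (widen_ord (leqnSn _) p) j) | j < k.+1] =
  [tuple tnth (tupd x p z) (lift_perm ord_max p 1%g i) | i < k.+1].
  apply: eq_from_tnth => i; rewrite tnth_mktuple [RHS]tnth_mktuple.
  have [j ->|->] := unliftP ord_max i.
    rewrite lift_perm_lift perm1 tnth_tupd eq_sym (negPf (neq_lift _ _)).
    rewrite tnth_mktuple; congr tnth; apply: val_inj => /=.
    by rewrite [bump k j]/bump leqNgt ltn_ord.
  rewrite lift_perm_id tnth_tupd eqxx; congr tnth; apply: val_inj => /=.
  by rewrite /bump -ltnS ltn_ord.
rewrite E scalerA -scaleN1r; congr (_ *: _).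
(* The exponents k + 1 - p and k + p, the latter from the cycle, have an odd sum. *)
rewrite subSS -signr_odd -signr_addb oddB; last by rewrite ltnW.
by rewrite /=; case: (odd k); case: (odd p).
Qed.

(** Turns the alternating sum of (iii) into an exchange sum: the last letter has sign +1, and
    [wedge_omit] treats the others. *)
Lemma omit_sum k (W : lmodType K) (F : g -> {linear ext g k.+1 -> W})
    (y : k.+2.-tuple g) (x := init_tuple y) (z := tnth y ord_max) :
  \sum_(p < k.+2) (-1) ^+ (k.+2 - p.+1) *:
    F (tnth y p) (wedge [tuple tnth y (fintype.lift p j) | j < k.+1]) =
  F z (wedge x) - \sum_(p < k.+1) F (tnth x p) (wedge (tupd x p z)).
Proof.
rewrite big_ord_recr /= subnn scale1r addrC; congr (_ + _).
  congr (F _ (wedge _)); apply: eq_from_tnth => j; rewrite !tnth_mktuple.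
  by congr tnth; apply: val_inj; rewrite /= /bump leqNgt ltn_ord.
rewrite -sumrN; apply: eq_bigr => p _.
by rewrite -linearZ wedge_omit linearN tnth_mktuple.
Qed.

End Wedge.

(** * Exchange relations for [rho] and the axioms for its dual *)

Section DualRepresentation.
Context {K : fieldType} {k : nat} {g : lmodType K} (A : nHomLie k g).
Context {V : lmodType K} (rho : {linear ext g k.+1 -> {linear V -> V}}).
Context (beta : GL V).
Hypothesis rho_rep : is_representation A rho beta.
Local Notation alpha := (twist A).
Local Notation m := k.+1.

(** With the 2m letters indexed by a disjoint sum, moving letters between the two factors is
    precomposition with a transposition. *)
Definition ltuple (w : 'I_m + 'I_m -> g) : m.-tuple g :=
  [tuple w (inl i) | i < m].
Definition rtuple (w : 'I_m + 'I_m -> g) : m.-tuple g :=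
  [tuple w (inr i) | i < m].

Definition rho2 (X Y : ext g m) (v : V) : V :=
  rho (ext_map m alpha X) (rho Y v).

(* The letters of w at the positions inl i form the first factor. *)
Definition Phi v (w : 'I_m + 'I_m -> g) : V :=
  rho2 (wedge (ltuple w)) (wedge (rtuple w)) v.

Fact rho2l_linear Y v a X X' :
  rho2 (a *: X + X') Y v = a *: rho2 X Y v + rho2 X' Y v.
Proof. by rewrite /rho2 !linearP. Qed.

Fact rho2r_linear X v a Y Y' :
  rho2 X (a *: Y + Y') v = a *: rho2 X Y v + rho2 X Y' v.
Proof. by rewrite /rho2 linearP lin_addE lin_scaleE linearP. Qed.

Definition rho2l Y v : {linear ext g m -> V} := LinMap (rho2l_linear Y v).
Definition rho2r X v : {linear ext g m -> V} := LinMap (rho2r_linear X v).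

Lemma Phi_tperml v w a b : a != b ->
  Phi v (w \o tperm (inl a) (inl b)) = - Phi v w.
Proof.
move=> ab; rewrite /Phi.
have inl_inj : injective (@inl 'I_m 'I_m) by move=> ? ? [].
have -> : rtuple (w \o tperm (inl a) (inl b)) = rtuple w.
  by apply: eq_from_tnth => i; rewrite !tnth_mktuple /= tpermD.
have -> : wedge (ltuple (w \o tperm (inl a) (inl b))) = - wedge (ltuple w).
  rewrite -(wedge_tperm (w \o inl) ab); congr wedge.
  apply: eq_from_tnth => i.
  by rewrite !tnth_mktuple /= (inj_tperm _ _ _ inl_inj).
exact: (linearN (rho2l _ _)).
Qed.

Lemma Phi_tpermr v w a b : a != b ->
  Phi v (w \o tperm (inr a) (inr b)) = - Phi v w.
Proof.
move=> ab; rewrite /Phi.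
have inr_inj : injective (@inr 'I_m 'I_m) by move=> ? ? [].
have -> : ltuple (w \o tperm (inr a) (inr b)) = ltuple w.
  by apply: eq_from_tnth => i; rewrite !tnth_mktuple /= tpermD.
have -> : wedge (rtuple (w \o tperm (inr a) (inr b))) = - wedge (rtuple w).
  rewrite -(wedge_tperm (w \o inr) ab); congr wedge.
  apply: eq_from_tnth => i.
  by rewrite !tnth_mktuple /= (inj_tperm _ _ _ inr_inj).
exact: (linearN (rho2r _ _)).
Qed.

Lemma ltuple_exchange w p i :
  ltuple (w \o tperm (inl p) (inr i)) = tupd (ltuple w) p (w (inr i)).
Proof.
apply: eq_from_tnth => j; rewrite tnth_tupd !tnth_mktuple /=.
case: tpermP => [[->]|//|jp _]; first by rewrite eqxx.
by case: eqVneq jp => [->|].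
Qed.

Lemma rtuple_exchange w p i :
  rtuple (w \o tperm (inl p) (inr i)) = tupd (rtuple w) i (w (inl p)).
Proof.
apply: eq_from_tnth => j; rewrite tnth_tupd !tnth_mktuple /=.
case: tpermP => [//|[->]|_ ji]; first by rewrite eqxx.
by case: eqVneq ji => [->|].
Qed.

Lemma tupd_max n (y : n.+1.-tuple g) z :
  tupd y ord_max z = [tuple of rcons (init_tuple y) z].
Proof.
rewrite -[LHS]rcons_init tnth_tupd eqxx; congr [tuple of rcons _ z].
apply: eq_from_tnth => j; rewrite !tnth_mktuple -val_eqE /=.
by rewrite ltn_eqF.
Qed.

(** This is (iii) for the left letters followed by the last right one; up to sign, omitting a left
    letter exchanges it with that last one. *)
Lemma rho_br_max v w :
  rho (wedge [tuple of rcons (map_tuple alpha (init_tuple (rtuple w)))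
        (br A (wedge [tuple of rcons (ltuple w) (w (inr ord_max))]))])
    (beta v) =
  Phi v w - \sum_p Phi v (w \o tperm (inl p) (inr ord_max)).
Proof.
rewrite (rep_br rho_rep).
set x := init_tuple _; set y := [tuple of rcons _ _].
pose F z := rho2l (wedge [tuple of rcons x z]) v.
transitivity (\sum_(i < k.+2) (-1) ^+ (k.+2 - i.+1) *:
    F (tnth y i) (wedge [tuple tnth y (fintype.lift i j) | j < k.+1])).
  apply: eq_bigr => i _; congr (_ *: rho _ _).
  rewrite ext_mapE; congr wedge; apply: eq_from_tnth => j.
  by rewrite tnth_mktuple [RHS]tnth_map tnth_mktuple.
rewrite omit_sum tnth_rcons_max init_rcons; congr (_ - _).
  rewrite /Phi -[X in rho2 _ (wedge X) _](rcons_init (rtuple w)).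
  by rewrite tnth_mktuple.
apply: eq_bigr => p _; rewrite /Phi ltuple_exchange rtuple_exchange tupd_max.
by rewrite tnth_mktuple.
Qed.

(** Exchanging the right letters at i and at the end moves the bracket to the last place and changes
    the sign of both sides, which reduces to [rho_br_max]. *)
Lemma rho_br_tupd v w i :
  rho (wedge (tupd (map_tuple alpha (rtuple w)) i
        (br A (wedge [tuple of rcons (ltuple w) (w (inr i))])))) (beta v) =
  Phi v w - \sum_p Phi v (w \o tperm (inl p) (inr i)).
Proof.
have init_map n (y : n.+1.-tuple g) :
    init_tuple (map_tuple alpha y) = map_tuple alpha (init_tuple y).
  apply: eq_from_tnth => j.
  by rewrite [LHS]tnth_mktuple [LHS]tnth_map [RHS]tnth_map tnth_mktuple.
have [->|ni] := eqVneq i ord_max.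
  by rewrite tupd_max init_map rho_br_max.
set z := br A _.
pose w' := w \o tperm (inr i) (inr ord_max).
have inr_inj : injective (@inr 'I_m 'I_m) by move=> ? ? [].
have := rho_br_max v w'.
have -> : ltuple w' = ltuple w.
  by apply: eq_from_tnth => j; rewrite !tnth_mktuple /w' /= tpermD.
have -> : w' (inr ord_max) = w (inr i) by rewrite /w' /= tpermR.
rewrite -/z -init_map -tupd_max.
have -> : wedge (tupd (map_tuple alpha (rtuple w')) ord_max z) =
          - wedge (tupd (map_tuple alpha (rtuple w)) i z).
  set t := tupd _ i z.
  rewrite -[t](_ : [tuple tnth t j | j < m] = _);
    last by apply: eq_from_tnth => j; rewrite tnth_mktuple.
  rewrite -(wedge_tperm _ ni); congr wedge; apply: eq_from_tnth => j.
  rewrite [RHS]tnth_mktuple !tnth_tupd ![tnth (map_tuple alpha _) _]tnth_map.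
  rewrite !tnth_mktuple /w' /=.
  rewrite -(inj_tperm _ _ _ inr_inj).
  have -> : (tperm i ord_max j == i) = (j == ord_max); last by [].
  by rewrite -[X in _ == X](tpermR i ord_max) (inj_eq perm_inj).
rewrite linearN lin_oppE => /(canRL (@opprK _)) ->.
rewrite opprB [Phi v w'](Phi_tpermr _ _ ni) opprK addrC; congr (_ + _).
rewrite -sumrN; apply: eq_bigr => p _.
rewrite -(Phi_tpermr _ _ ni); congr Phi; apply: funext => u /=.
congr w.
(* The transposition of [inr i] and [inr ord_max] conjugates one exchange into the other. *)
rewrite [LHS](inj_tperm _ _ _ (@perm_inj _ (tperm (inr i) (inr ord_max)))).
by rewrite tpermR [tperm _ _ (inl p)]tpermD.
Qed.

(** Condition (ii), with each summand of [X, Y]_F expanded by (iii); it is the hypothesis of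
    [bipartite_exchange0]. *)
Lemma Phi_swap v w : Phi v w - Phi v (w \o @swap m) =
  \sum_i (Phi v w - \sum_p Phi v (w \o tperm (inl p) (inr i))).
Proof.
rewrite /Phi; have -> : ltuple (w \o @swap m) = rtuple w by [].
have -> : rtuple (w \o @swap m) = ltuple w by [].
rewrite (rep_brF rho_rep) brFE linear_sum.
rewrite (big_morph (fun f : {linear V -> V} => f (beta v))
  (id1 := 0) (op1 := +%R)) //.
apply: eq_bigr => i _; rewrite -rho_br_tupd.
by rewrite tnth_mktuple.
Qed.

(** Transposition reverses products, so the dual needs (iii) with B in place of A;
    [bipartite_exchange0] supplies A + B = 0. *)
Lemma rep_br_opp (charK0 : [pchar K] =i pred0)
    (x : k.-tuple g) (y : k.+2.-tuple g) v :
  rho (wedge [tuple of rcons (map_tuple alpha x) (br A (wedge y))]) (beta v) =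
  - \sum_(i < k.+2) (-1) ^+ (k.+2 - i.+1) *:
      rho2 (wedge [tuple of rcons x (tnth y i)])
           (wedge [tuple tnth y (fintype.lift i j) | j < k.+1]) v.
Proof.
(* The last letter of y goes to the right end, so that the bracket in [rho_br_max] is that of y. *)
pose w (u : 'I_m + 'I_m) := match u with
  | inl i => tnth (init_tuple y) i
  | inr i => tnth [tuple of rcons x (tnth y ord_max)] i end.
have lE : ltuple w = init_tuple y.
  by apply: eq_from_tnth => j; rewrite tnth_mktuple.
have rE : rtuple w = [tuple of rcons x (tnth y ord_max)].
  by apply: eq_from_tnth => j; rewrite tnth_mktuple.
have wmax : w (inr ord_max) = tnth y ord_max by exact: tnth_rcons_max.
have := rho_br_max v w; rewrite lE rE init_rcons wmax rcons_init => ->.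
have := bipartite_exchange0 charK0 (@Phi_tperml v) (@Phi_tpermr v) (Phi_swap v)
  w ord_max.
move/eqP; rewrite addr_eq0 => /eqP ->; congr (- _); apply/esym.
pose F z := rho2r (wedge [tuple of rcons x z]) v.
rewrite (omit_sum F); congr (_ - _); first by rewrite /F /= -rE -lE.
apply: eq_bigr => p _; rewrite /F /=.
rewrite /Phi.
set w' := w \o tperm (inl p) (inr ord_max).
have -> : ltuple (w' \o @swap m) = rtuple w' by [].
have -> : rtuple (w' \o @swap m) = ltuple w' by [].
by rewrite ltuple_exchange rtuple_exchange tupd_max rE init_rcons lE wmax.
Qed.

Lemma gl_inv_rho X v :
  gl_inv beta (rho (ext_map m alpha X) v) = rho X (gl_inv beta v).
Proof.
by apply: (canLR (gl_funK beta)); rewrite -(rep_twist rho_rep) gl_invK.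
Qed.

(** The two signs cancel and transposition interchanges X and Y; moving the inner beta^-2 to the
    right past the factor of X removes its two twists. *)
Lemma star_rho2 X Y (xi : dual V) u :
  star_rho A rho beta (ext_map m alpha X) (star_rho A rho beta Y xi) u =
  xi (gl_inv beta (gl_inv beta (rho2 Y X (gl_inv beta (gl_inv beta u))))).
Proof.
rewrite !star_rhoE dual_rhoE /betaV2T transposeE dual_rhoE opprK transposeE /=.
by rewrite !gl_inv_rho.
Qed.

Lemma star_rho_beta X (xi : dual V) u :
  star_rho A rho beta X (GLtranspose (GLinv beta) xi) u =
  - xi (gl_inv beta (gl_inv beta (rho X (gl_inv beta u)))).
Proof.
transitivity (- xi (gl_inv beta (gl_inv beta (gl_inv beta
    (rho (ext_map m alpha X) u))))); first by [].
by rewrite gl_inv_rho.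
Qed.

Lemma star_rho_representation (charK0 : [pchar K] =i pred0) :
  is_representation A (star_rho A rho beta) (GLtranspose (GLinv beta)).
Proof.
split.
- by move=> X xi; apply: linP => u; rewrite star_rho_beta.
- move=> X Y xi; apply: linP => u; rewrite star_rho_beta.
  have -> : rho (brF A X Y) (gl_inv beta u) =
      rho2 X Y (gl_inv beta (gl_inv beta u)) -
      rho2 Y X (gl_inv beta (gl_inv beta u)).
    by rewrite (rep_brF rho_rep) gl_invK.
  rewrite 2!(linearB (gl_inv beta)) (linearB (xi : {linear V -> K^o})).
  (* The sign of the dual compensates the interchange of X and Y in [star_rho2]. *)
  rewrite opprB; congr (_ - _); exact: star_rho2.
move=> x y xi; apply: linP => u; rewrite star_rho_beta.
(* Here beta^-1 u is written as beta applied to beta^-2 u to fit [rep_br_opp], whose sign cancels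
   that of the dual. *)
rewrite -{1}[gl_inv beta u](gl_invK beta) rep_br_opp //.
rewrite !linearN opprK !linear_sum.
rewrite [RHS](big_morph (fun f : dual V => f u) (id1 := 0) (op1 := +%R)) //.
apply: eq_bigr => i _; rewrite !linearZ /=; congr (_ *: _).
rewrite -star_rho2 ext_mapE.
set t := [tuple alpha _ | _ < _]; set t' := map_tuple alpha _.
suff -> : t = t' by [].
by apply: eq_from_tnth => j; rewrite [RHS]tnth_map !tnth_mktuple.
Qed.

End DualRepresentation.

Theorem theorem3p9 (K : closedFieldType) (charK0 : [pchar K] =i pred0)
    (k : nat) (g : lmodType K) (A : nHomLie k g) (V : lmodType K)
    (rho : {linear ext g k.+1 -> {linear V -> V}}) (beta : GL V)
    (rho_rep : is_representation A rho beta) :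
  is_representation A (star_rho A rho beta) (GLtranspose (GLinv beta)).
Proof. exact: star_rho_representation. Qed.
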